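(* Let $\{P^{[n]}\in\mathbb{R}^{n\times n}\}_{n\in\mathbb{N}}$ be a sequence of stochastic matrices of increasing dimensions, and suppose there is no $P^{[n]}$-prominent family. Then (i) for every $k\in\mathbb{N}$ there is no $(P^{[n]})^k$-prominent family, and (ii) the sequence $\{P^{[n]}\}$ is finite-time wise.
   Context: A matrix $P$ is stochastic if $P\ge0$ and $P\mathbf{1}=\mathbf{1}$. Given a sequence of $n\times n$ stochastic matrices $\{Q^{[n]}\}$, a $Q^{[n]}$-prominent family is a sequence of sets $\mathcal{B}^{[n]}\subseteq\{1,\dots,n\}$ with $|\mathcal{B}^{[n]}|=o(n)$ whose total one-time influence $\frac1n\sum_{i=1}^n\sum_{j\in\mathcal{B}^{[n]}}Q^{[n]}_{ij}$ is of order $1$; here ''there is no $Q^{[n]}$-prominent family'' means: for every sequence of sets $\mathcal{B}^{[n]}\subseteq\{1,\dots,n\}$ with $|\mathcal{B}^{[n]}|=o(n)$, one has $\frac1n\sum_{i=1}^n\sum_{j\in\mathcal{B}^{[n]}}Q^{[n]}_{ij}\to0$ as $n\to\infty$. Finite-time wisdom: for each $n$, $x^{[n]}_i(0)=\mu+\xi^{[n]}_i(0)$ with $\mu\in\mathbb{R}$ fixed and $\xi^{[n]}_i(0)$ independent Gaussian with mean $0$ and common finite variance $\sigma^2$; $x^{[n]}(k+1)=P^{[n]}x^{[n]}(k)$; the sequence is finite-time wise if for every $k\in\mathbb{N}$, $\frac1n\sum_i x^{[n]}_i(k)\to\mu$ in probability as $n\to\infty$. *)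

(* Defs.v *)
From HB Require Import structures.
From mathcomp Require Import all_boot all_order all_algebra.
From mathcomp Require Import all_classical all_reals all_analysis.
Set Implicit Arguments. Unset Strict Implicit. Unset Printing Implicit Defensive.
Import Order.TTheory GRing.Theory Num.Theory.
Import numFieldNormedType.Exports.
Local Open Scope classical_set_scope.
Local Open Scope ring_scope.

Section defs.
Variable R : realType.

Definition stochastic (n : nat) (M : 'M[R]_n) : Prop :=
  (forall i j, 0 <= M i j) /\ (forall i, \sum_(j < n) M i j = 1).

Definition mxpow (n : nat) (M : 'M[R]_n) (k : nat) : 'M[R]_n :=
  iter k (mulmx M) 1%:M.

Definition influence (n : nat) (Q : 'M[R]_n) (B : {set 'I_n}) : R :=
  n%:R^-1 * \sum_(i < n) \sum_(j in B) Q i j.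

Definition no_prominent_family (Q : forall n : nat, 'M[R]_n) : Prop :=
  forall B : forall n : nat, {set 'I_n},
    (fun n : nat => (#|B n|)%:R / n%:R : R) @ \oo --> (0 : R) ->
    (fun n : nat => influence (Q n) (B n)) @ \oo --> (0 : R).

Definition mutually_independent d (T : measurableType d) (Pr : probability T R)
    (n : nat) (X : 'I_n -> T -> R) : Prop :=
  forall B : 'I_n -> set R, (forall i, measurable (B i)) ->
    Pr [set t | forall i, B i (X i t)] = (\prod_(i < n) Pr (X i @^-1` B i))%E.

Definition gaussian d (T : measurableType d) (Pr : probability T R)
    (X : T -> R) (m s : R) : Prop :=
  forall A : set R, measurable A -> Pr (X @^-1` A) = normal_prob m s A.

Definition opinions (n : nat) (M : 'M[R]_n) (x0 : 'cV[R]_n) (k : nat)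
  : 'cV[R]_n := iter k (mulmx M) x0.

Definition average (n : nat) (x : 'cV[R]_n) : R :=
  n%:R^-1 * \sum_(i < n) x i ord0.

Definition finite_time_wise (P : forall n : nat, 'M[R]_n) : Prop :=
  forall (d : measure_display) (T : measurableType d) (Pr : probability T R)
         (mu sigma : R) (xi : forall n : nat, 'I_n -> T -> R),
    0 < sigma ->
    (forall n i, measurable_fun setT (xi n i)) ->
    (forall n, mutually_independent Pr (xi n)) ->
    (forall n i, gaussian Pr (xi n i) 0 sigma) ->
    forall (k : nat) (eps : R), 0 < eps ->
      (fun n : nat =>
         Pr [set t | eps <= `| average
               (opinions (P n) (\col_(i < n) (mu + xi n i t)) k) - mu |])
        @ \oo --> 0%E.

End defs.

(* Main.v *)
(* Let v_l be the total weight that Q = P^k puts from row l on B.  If the mean of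
   v tends to 0 then, by Markov's inequality, {l | v_l > d} is a set of size o(n)
   for each d > 0, so its P-influence vanishes; and P Q has B-influence at most
   d more than that.  Induction on k gives (i).
   For (ii), the average at time k is mu + sum_j w_j xi_j, where w_j is the
   P^k-influence of {j} and sum_j w_j = 1.  By (i) applied to the singleton of a
   most influential agent, max_j w_j -> 0, so sum_j w_j^2 <= max_j w_j -> 0, and
   Chebyshev's inequality concludes. *)
Require Import Defs.
From HB Require Import structures.
From mathcomp Require Import all_boot all_order all_algebra.
From mathcomp Require Import all_classical all_reals all_analysis.
From mathcomp Require Import measurable_realfun ring lra.
Set Implicit Arguments. Unset Strict Implicit. Unset Printing Implicit Defensive.
Import Order.TTheory GRing.Theory Num.Theory.
Import numFieldNormedType.Exports.
Local Open Scope classical_set_scope.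
Local Open Scope ring_scope.

(** * Stochastic matrices, influence, and averages as weighted sums *)

Section stochastic_matrices.
Variables (R : realType) (n : nat).
Implicit Types (M Q : 'M[R]_n) (B : {set 'I_n}).

Lemma stochastic1 : stochastic (1%:M : 'M[R]_n).
Proof.
split=> [i j|i]; first by rewrite mxE ler0n.
rewrite (bigD1 i)//= big1 ?addr0 => [|j ji]; rewrite mxE ?eqxx//.
by rewrite eq_sym (negbTE ji).
Qed.

Lemma stochastic_mulmx M Q :
  stochastic M -> stochastic Q -> stochastic (M *m Q).
Proof.
move=> [M0 M1] [Q0 Q1]; split=> [i j|i].
  by rewrite mxE sumr_ge0// => l _; rewrite mulr_ge0.
under eq_bigr do rewrite mxE.
rewrite exchange_big/= -[RHS](M1 i); apply: eq_bigr => l _.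
by rewrite -mulr_sumr Q1 mulr1.
Qed.

Lemma stochastic_mxpow M k : stochastic M -> stochastic (mxpow M k).
Proof.
by move=> sM; elim: k => [|k]; [exact: stochastic1|exact: stochastic_mulmx].
Qed.

Lemma influence_ge0 M B : stochastic M -> 0 <= influence M B.
Proof.
move=> [M0 _]; rewrite mulr_ge0 ?invr_ge0//.
by apply: sumr_ge0 => i _; apply: sumr_ge0.
Qed.

Lemma influence1 B : influence (1%:M : 'M[R]_n) B = #|B|%:R / n%:R.
Proof.
rewrite /influence mulrC exchange_big/=; congr (_ / _).
rewrite -sum1_card natr_sum; apply: eq_bigr => j _.
rewrite (bigD1 j)//= big1 ?addr0 => [|i ij]; rewrite mxE ?eqxx//.
by rewrite (negbTE ij).
Qed.

Lemma influence_set1 M j : influence M [set j]%SET = n%:R^-1 * \sum_i M i j.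
Proof. by congr (_ * _); apply: eq_bigr => i _; rewrite big_set1. Qed.

Definition exposed (Q : 'M[R]_n) (B : {set 'I_n}) (d : R) : {set 'I_n} :=
  [set l | d < \sum_(j in B) Q l j]%SET.

(** Markov's inequality for the uniform measure on agents: every exposed row contributes at least
    [d] to the sum defining the influence of [B]. *)
Lemma card_exposed Q B d : stochastic Q -> 0 < d ->
  #|exposed Q B d|%:R / n%:R <= influence Q B / d.
Proof.
move=> [Q0 _] d0; rewrite ler_pdivlMr// /influence mulrAC mulrC.
rewrite ler_wpM2l ?invr_ge0// mulr_natl -sumr_const big_mkcond/=.
apply: ler_sum => l _; rewrite inE; case: ltP => [/ltW//|_].
exact: sumr_ge0.
Qed.

(** Split the two-step weight by the intermediate agent [l]. An exposed [l] passes on at most its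
    whole row of [Q], of sum 1; any other passes on at most [d], and the weights [M i l] sum to
    1. *)
Lemma influence_mulmx M Q B d : stochastic M -> stochastic Q -> 0 <= d ->
  influence (M *m Q) B <= influence M (exposed Q B d) + d.
Proof.
move=> [M0 M1] [Q0 Q1] d0.
have rowE i : \sum_(j in B) (M *m Q) i j <=
    \sum_(l in exposed Q B d) M i l + d.
  under eq_bigr do rewrite mxE.
  have {2}-> : d = \sum_l M i l * d by rewrite -mulr_suml M1 mul1r.
  rewrite exchange_big/=.
  rewrite [X in _ <= X + _]big_mkcond/= -big_split/=; apply: ler_sum => l _.
  rewrite -mulr_sumr inE; case: ltP => [_|lb]; last first.
    by rewrite add0r ler_wpM2l.
  rewrite ler_wpDr ?mulr_ge0// ler_piMr// -(Q1 l) [leRHS](bigID (mem B))/=.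
  by rewrite lerDl sumr_ge0.
apply: le_trans (_ : n%:R^-1 *
    (\sum_i \sum_(l in exposed Q B d) M i l + d *+ n) <= _).
  rewrite ler_wpM2l ?invr_ge0//.
  rewrite -[X in d *+ X]card_ord -sumr_const -big_split/=.
  exact: ler_sum.
(* For [n = 0] the inverse is 0 by convention, and the bound reduces to [0 <= d]. *)
rewrite mulrDr lerD2l; have [->|n0] := posnP n; first by rewrite invr0 mul0r.
by rewrite -[d *+ n]mulr_natl mulKf// pnatr_eq0 -lt0n.
Qed.

Lemma opinionsE M (x : 'cV[R]_n) k : opinions M x k = mxpow M k *m x.
Proof.
by elim: k => [|k IH]; rewrite /= ?mul1mx// -mulmxA -IH.
Qed.

Lemma averageE M (x : 'cV[R]_n) :
  average (M *m x) = \sum_j influence M [set j]%SET * x j ord0.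
Proof.
rewrite /average mulr_sumr; under eq_bigr do rewrite mxE mulr_sumr.
rewrite exchange_big/=; apply: eq_bigr => j _.
by rewrite influence_set1 mulr_sumr mulr_suml; apply: eq_bigr => i _; ring.
Qed.

Lemma sum_influence_set1 M : (0 < n)%N -> stochastic M ->
  \sum_j influence M [set j]%SET = 1.
Proof.
move=> n0 [_ M1]; under eq_bigr do rewrite influence_set1.
rewrite -mulr_sumr exchange_big/=; under eq_bigr do rewrite M1.
by rewrite sumr_const card_ord mulVf// pnatr_eq0 -lt0n.
Qed.

End stochastic_matrices.

(** * Absence of prominent families: products, powers and squared influences *)

Section prominent_families.
Variable R : realType.
Implicit Types P Q : forall n, 'M[R]_n.

Lemma no_prominent_family_mulmx P Q :
  (forall n, stochastic (P n)) -> (forall n, stochastic (Q n)) ->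
  no_prominent_family P -> no_prominent_family Q ->
  no_prominent_family (fun n => P n *m Q n).
Proof.
move=> sP sQ hP hQ B hB; apply/cvgr0Pnorm_lt => e e0.
(* Half of the tolerance serves as the exposure threshold; the other half bounds the [P]-influence
   of the exposed sets for large [n]. *)
have e20 : 0 < e / 2 by rewrite divr_gt0.
have : (fun n => influence (P n) (exposed (Q n) (B n) (e / 2))) @ \oo
    --> (0 : R).
  apply: hP; apply: (@squeeze_cvgr _ _ _ _ (cst 0)
    (fun n => influence (Q n) (B n) / (e / 2))); last 2 first.
  - exact: cvg_cst.
  - by rewrite -(mul0r (e / 2)^-1); apply: cvgM; [exact: hQ|exact: cvg_cst].
  by near=> n; rewrite divr_ge0//= card_exposed.
move/cvgr0Pnorm_lt => /(_ _ e20); apply: filterS => n.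
have sPQ := stochastic_mulmx (sP n) (sQ n).
rewrite !ger0_norm ?influence_ge0//.
have := influence_mulmx (B n) (sP n) (sQ n) (ltW e20); lra.
Unshelve. all: end_near. Qed.

Lemma no_prominent_family_mxpow P k : (forall n, stochastic (P n)) ->
  no_prominent_family P -> no_prominent_family (fun n => mxpow (P n) k).
Proof.
move=> sP hP; elim: k => [B hB|k IH].
  (* The influence of [B] under the identity is its density, which tends to 0 by assumption. *)
  by under eq_fun do rewrite influence1.
apply: no_prominent_family_mulmx => // n; exact: stochastic_mxpow.
Qed.

(* The option type accommodates n = 0, where there is no agent to choose. *)
Lemma no_prominent_singleton Q (j : forall n, option 'I_n) :
  no_prominent_family Q ->
  (fun n => influence (Q n) (if j n is Some i then [set i] else finset.set0)%SET)
    @ \oo --> (0 : R).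
Proof.
move=> hQ; apply: (hQ (fun n => if j n is Some i then [set i] else finset.set0)%SET).
apply: (@squeeze_cvgr _ _ _ _ (cst 0) (fun n => n%:R^-1)); last 2 first.
- exact: cvg_cst.
- apply/gtr0_cvgV0; last exact/cvgrnyP.
  by near=> n; rewrite ltr0n; near: n; exact: nbhs_infty_gt.
near=> n; rewrite divr_ge0//=; case: (j n) => [i|].
  by rewrite cards1 mul1r.
by rewrite cards0 mul0r invr_ge0.
Unshelve. all: end_near. Qed.

Lemma cvg_sum_influence_sqr Q : (forall n, stochastic (Q n)) ->
  no_prominent_family Q ->
  (fun n => \sum_j influence (Q n) [set j]%SET ^+ 2) @ \oo --> (0 : R).
Proof.
move=> sQ hQ.
pose j n := [pick i : 'I_n | [forall l,
  influence (Q n) [set l] <= influence (Q n) [set i]]]%SET.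
apply: (squeeze_cvgr _ (cvg_cst 0) (no_prominent_singleton j hQ)).
near=> n; have n0 : (0 < n)%N by near: n; exact: nbhs_infty_gt.
apply/andP; split; first by apply: sumr_ge0 => i _; exact: sqr_ge0.
rewrite /j; case: pickP => [i /forallP hi|/= hno]; last first.
  (* A nonempty finite set of agents has a most influential one, so the choice cannot fail. *)
  have i0 : 'I_n by exact: Ordinal n0.
  have [i _ hi] := @arg_maxP _ _ _ i0 xpredT
    (fun i => influence (Q n) [set i]%SET) isT.
  have /negP[] := negbT (hno i).
  by apply/forallP => l; exact: hi.
apply: le_trans (_ : \sum_l influence (Q n) [set i]%SET *
    influence (Q n) [set l]%SET <= _).
  by apply: ler_sum => l _; rewrite expr2 ler_wpM2r ?influence_ge0.
by rewrite -mulr_sumr sum_influence_set1// mulr1.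
Unshelve. all: end_near. Qed.

End prominent_families.

(** * Integrals against the normal law *)

Section normal_moments.
Variable R : realType.
Local Notation mu := (@lebesgue_measure R).

(** The Radon-Nikodym derivative of the normal law and [normal_pdf] have the same integral over
    every measurable set, hence agree almost everywhere. *)
Lemma ge0_integral_normal_prob (m s : R) (f : R -> \bar R) :
  measurable_fun [set: R] f -> (forall x, 0 <= f x)%E ->
  (\int[normal_prob m s]_x f x = \int[mu]_x (f x * (normal_pdf m s x)%:E))%E.
Proof.
move=> mf f0; have dom := @normal_prob_dominates R m s.
rewrite -(Radon_Nikodym_SigmaFinite.change_of_variables dom f0)//.
have mpdf : measurable_fun [set: R] (EFin \o normal_pdf m s).
  by apply/measurable_EFinP; exact: measurable_normal_pdf.
have irn := Radon_Nikodym_SigmaFinite.f_integrable dom.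
apply: ae_eq_integral => //.
- by apply: emeasurable_funM => //; exact: measurable_int irn.
- exact: emeasurable_funM.
- apply: ae_eqe_mul2l; apply: integral_ae_eq => // E _ mE.
  by rewrite -Radon_Nikodym_SigmaFinite.f_integral.
Qed.

(** Doubling the deviation leaves enough room in the exponent to absorb the factor [x ^+ 2]; this
    gives a finite second moment without computing it. *)
Lemma sqr_mul_normal_pdf_le (s : R) : 0 < s ->
  {C | forall x, x ^+ 2 * normal_pdf 0 s x <= C * normal_pdf 0 (2 * s) x}.
Proof.
move=> s0; have s20 : 0 < 2 * s by rewrite mulr_gt0.
have ps0 := normal_peak_gt0 (lt0r_neq0 s0).
have pt0 := normal_peak_gt0 (lt0r_neq0 s20).
(* The exponents differ by [3 * x ^+ 2 / (8 * s ^+ 2)], whence the first factor; the quotient of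
   peaks adjusts the normalisation. *)
exists (8 * s ^+ 2 / 3 * (normal_peak s / normal_peak (2 * s))) => x.
rewrite !normal_pdfE ?gt_eqF// mulrCA.
rewrite [leRHS](_ : _ = normal_peak s *
    (8 * s ^+ 2 / 3 * normal_fun 0 (2 * s) x)); last first.
  by field; rewrite gt_eqF.
rewrite ler_wpM2l ?(ltW ps0)//.
(* [x^2] is a multiple of [a <= exp a], and [exp a] is exactly the ratio of the
   two Gaussian factors. *)
set a := 3 * x ^+ 2 / (8 * s ^+ 2).
have -> : x ^+ 2 = 8 * s ^+ 2 / 3 * a.
  by rewrite /a; field; rewrite gt_eqF.
rewrite -[leLHS]mulrA ler_wpM2l /normal_fun ?subr0//.
  by rewrite divr_ge0// mulr_ge0// sqr_ge0.
have -> : - x ^+ 2 / ((2 * s) ^+ 2 *+ 2) = a + - x ^+ 2 / (s ^+ 2 *+ 2).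
  by rewrite /a; field; rewrite gt_eqF.
rewrite expRD ler_wpM2r ?expR_ge0//.
by apply: le_trans (expR_ge1Dx a); rewrite lerDr.
Qed.

(** Finiteness suffices for the law of large numbers: the deviation bound multiplies this constant
    by a factor tending to 0. *)
Lemma normal_prob_second_moment_lty (s : R) : 0 < s ->
  (\int[normal_prob 0 s]_x (x ^+ 2)%:E < +oo)%E.
Proof.
move=> s0; have [C hC] := sqr_mul_normal_pdf_le s0.
rewrite ge0_integral_normal_prob; last 2 first.
- by apply/measurable_EFinP; exact: measurable_funX.
- by move=> x; rewrite lee_fin sqr_ge0.
apply: (@le_lt_trans _ _ (\int[mu]_x (C%:E * (normal_pdf 0 (2 * s) x)%:E))%E).
  apply: ge0_le_integral => //=.
  - by move=> x _; rewrite lee_fin mulr_ge0 ?sqr_ge0 ?normal_pdf_ge0.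
  - apply/measurable_EFinP/measurable_funM; first exact: measurable_funX.
    exact: measurable_normal_pdf.
  - apply/measurable_EFinP/measurable_funM => //.
    exact: measurable_normal_pdf.
  - by move=> x _; rewrite lee_fin.
rewrite integralZl//; last exact: integrable_normal_pdf.
by rewrite integral_normal_pdf mule1 ltry.
Qed.

(** The centred density is even and Lebesgue measure is invariant under reflection. *)
Lemma normal_prob_opp (s : R) (A : set R) : s != 0 -> measurable A ->
  normal_prob 0 s (-%R @^-1` A) = normal_prob 0 s A.
Proof.
move=> s0 mA; rewrite /normal_prob.
have pdfN x : normal_pdf 0 s (- x) = normal_pdf 0 s x.
  by rewrite !normal_pdfE// /normal_fun !subr0 sqrrN.
transitivity (\int[pushforward mu (-%R : _ -> measurableTypeR R)]_(x in A)
    (normal_pdf 0 s x)%:E)%E.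
  rewrite ge0_integral_pushforward//.
  - by apply: eq_integral => x _; rewrite /= pdfN.
  - apply/measurable_EFinP; apply: measurable_funTS; exact: measurable_normal_pdf.
  - by move=> x _; rewrite lee_fin normal_pdf_ge0.
by apply: eq_measure_integral => B mB _; exact: lebesgue_measureN.
Qed.

(** * Weighted sums of independent Gaussian variables *)

Context d (T : measurableType d) (Pr : probability T R).

(** A measure that has the product values on all rectangles is the product measure, so the law of
    [(X, Y)] is [m1 \x m2]. *)
Lemma integral_joint_law (m1 m2 : probability (measurableTypeR R) R)
    (X Y : T -> R) (f : R * R -> \bar R) :
  measurable_fun setT X -> measurable_fun setT Y ->
  (forall A B, measurable A -> measurable B ->
    Pr (X @^-1` A `&` Y @^-1` B) = (m1 A * m2 B)%E) ->
  measurable_fun [set: R * R] f ->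
  Pr.-integrable setT (fun t => f (X t, Y t)) ->
  (\int[Pr]_t f (X t, Y t) = \int[m1 \x m2]_z f z)%E.
Proof.
move=> mX mY XYE mf If.
pose Z t : measurableTypeR R * measurableTypeR R := (X t, Y t).
have mZ : measurable_fun setT Z by exact: measurable_fun_pair.
have := @integral_pushforward _ _ _ _ _ Z mZ Pr setT f mf If measurableT.
rewrite preimage_setT => <-.
apply: eq_measure_integral => A mA _.
pose Z' : {mfun T >-> _} := HB.pack Z (isMeasurableFun.Build _ _ _ _ Z mZ).
by apply/esym; apply: (product_measure_unique (m' := distribution Pr Z')).
Qed.

(* Flipping the sign of [X] preserves the joint law, so [E(XY) = E(-XY)]. *)
Lemma integral_mul_indep_normal (X Y : T -> R) (s : R) : s != 0 ->
  measurable_fun setT X -> measurable_fun setT Y ->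
  (forall A B, measurable A -> measurable B ->
    Pr (X @^-1` A `&` Y @^-1` B) = (normal_prob 0 s A * normal_prob 0 s B)%E) ->
  Pr.-integrable setT (fun t => (X t * Y t)%:E) ->
  (\int[Pr]_t (X t * Y t)%:E = 0)%E.
Proof.
move=> s0 mX mY XYE iXY.
pose N := normal_prob 0 s : probability _ R.
pose f (z : R * R) := (z.1 * z.2)%:E.
have mf : measurable_fun [set: R * R] f.
  by apply/measurable_EFinP; exact: measurable_funM.
have mNX : measurable_fun setT (\- X) by exact: measurableT_comp.
have NXYE A B : measurable A -> measurable B ->
    Pr ((\- X) @^-1` A `&` Y @^-1` B) = (N A * N B)%E.
  move=> mA mB; rewrite -[N A]normal_prob_opp// -XYE//.
  by rewrite -[X in measurable X]setTI; exact: oppr_measurable.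
have iNXY : Pr.-integrable setT (fun t => f (- X t, Y t)).
  rewrite (_ : (fun _ => _) = (fun t => - (X t * Y t)%:E)%E).
    exact: integrableN.
  by apply/funext => t; rewrite /f/= mulNr EFinN.
have E1 := integral_joint_law (m1 := N) (m2 := N) mX mY XYE mf iXY.
have := integral_joint_law (m1 := N) (m2 := N) mNX mY NXYE mf iNXY.
rewrite -E1 /f/=.
under eq_integral do rewrite mulNr EFinN.
rewrite integralN/=; last exact: integrable_add_def.
have := integrable_fin_num measurableT iXY.
case: (integral _ _ _) => // r _ [] /eqP.
by rewrite -subr_eq0 -opprD oppr_eq0 -mulr2n mulrn_eq0/= => /eqP ->.
Qed.

Lemma gaussian_second_moment (X : T -> R) (s : R) :
  measurable_fun setT X -> gaussian Pr X 0 s ->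
  (\int[Pr]_t (X t ^+ 2)%:E = \int[normal_prob 0 s]_x (x ^+ 2)%:E)%E.
Proof.
move=> mX gX.
transitivity (\int[pushforward Pr (X : T -> measurableTypeR R)]_x (x ^+ 2)%:E)%E.
  rewrite ge0_integral_pushforward//.
  - by apply/measurable_EFinP; exact: measurable_funX.
  - by move=> x _; rewrite lee_fin sqr_ge0.
by apply: eq_measure_integral => A mA _; exact: gX.
Qed.

Lemma mutually_independent_pair n (X : 'I_n -> T -> R) i j (A B : set R) :
  mutually_independent Pr X -> i != j -> measurable A -> measurable B ->
  Pr (X i @^-1` A `&` X j @^-1` B) = (Pr (X i @^-1` A) * Pr (X j @^-1` B))%E.
Proof.
move=> indX ij mA mB.
(* The whole line is imposed on every other coordinate, which contributes a factor 1. *)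
pose C l := if l == i then A else if l == j then B else setT.
have ji : (j == i) = false by rewrite eq_sym (negbTE ij).
have := indX C _.
rewrite (_ : [set t | _] = X i @^-1` A `&` X j @^-1` B); last first.
  apply/seteqP; split=> [t /= h|t /= [hi hj] l].
    by split; [have := h i|have := h j]; rewrite /C ?eqxx ?ji ?eqxx.
  by rewrite /C; case: eqP => [->//|_]; case: eqP => [->|].
move=> ->; last by move=> l; rewrite /C; case: ifP => // _; case: ifP.
rewrite (bigD1 i)//= (bigD1 j)/=; last by rewrite eq_sym.
rewrite big1 ?mule1 /C ?eqxx ?ji ?eqxx// => l /andP[/negbTE-> /negbTE->].
by rewrite preimage_setT probability_setT.
Qed.

Lemma integrable_mul_sqr (X Y : T -> R) :
  measurable_fun setT X -> measurable_fun setT Y ->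
  Pr.-integrable setT (fun t => (X t ^+ 2)%:E) ->
  Pr.-integrable setT (fun t => (Y t ^+ 2)%:E) ->
  Pr.-integrable setT (fun t => (X t * Y t)%:E).
Proof.
move=> mX mY iX iY.
apply: (le_integrable measurableT _ _ (integrableD measurableT iX iY)).
  by apply/measurable_EFinP; exact: measurable_funM.
move=> t _; rewrite /= lee_fin [leRHS]ger0_norm ?addr_ge0 ?sqr_ge0//.
rewrite normrM -(real_normK (num_real (X t))) -(real_normK (num_real (Y t))).
(* The square gives twice [|X t * Y t|] at most [X t ^+ 2 + Y t ^+ 2]. *)
have := sqr_ge0 (`|X t| - `|Y t|).
have := mulr_ge0 (normr_ge0 (X t)) (normr_ge0 (Y t)).
nra.
Qed.

(** Expand the square: cross terms vanish by independence and symmetry, and the diagonal terms share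
    one Gaussian second moment. *)
Lemma second_moment_sum n (X : 'I_n -> T -> R) (w : 'I_n -> R) (s : R) :
  0 < s -> (forall i, measurable_fun setT (X i)) ->
  mutually_independent Pr X -> (forall i, gaussian Pr (X i) 0 s) ->
  (\int[Pr]_t ((\sum_i w i * X i t) ^+ 2)%:E =
   (\sum_i w i ^+ 2)%:E * \int[normal_prob 0 s]_x (x ^+ 2)%:E)%E.
Proof.
move=> s0 mX indX gX.
have iX2 i : Pr.-integrable setT (fun t => (X i t ^+ 2)%:E).
  apply/integrableP; split.
    by apply/measurable_EFinP; exact: measurable_funX.
  under eq_integral do rewrite gee0_abs ?lee_fin ?sqr_ge0//.
  by rewrite (gaussian_second_moment (mX i) (gX i)) normal_prob_second_moment_lty.
have iXX i j : Pr.-integrable setT (fun t => (X i t * X j t)%:E).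
  exact: integrable_mul_sqr.
have XX0 i j : i != j -> (\int[Pr]_t (X i t * X j t)%:E = 0)%E.
  move=> ij; apply: (@integral_mul_indep_normal _ _ s) => //.
    by rewrite gt_eqF.
  by move=> A B mA mB; rewrite mutually_independent_pair// gX// gX.
have sqE t : ((\sum_i w i * X i t) ^+ 2)%:E =
    (\sum_i \sum_j (w i * w j)%:E * (X i t * X j t)%:E)%E.
  rewrite expr2 mulr_suml -sumEFin; apply: eq_bigr => i _.
  rewrite mulr_sumr -sumEFin; apply: eq_bigr => j _.
  by rewrite -EFinM; congr EFin; ring.
under eq_integral do rewrite sqE.
have iw i j : Pr.-integrable setT
    (fun t => ((w i * w j)%:E * (X i t * X j t)%:E)%E).
  exact: integrableZl.
rewrite integral_sum//=; last by move=> i; exact: integrable_sum.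
rewrite -sumEFin ge0_sume_distrl; last by move=> i _; rewrite lee_fin sqr_ge0.
apply: eq_bigr => i _; rewrite integral_sum//= (bigD1 i)//= big1 ?adde0.
  by rewrite integralZl// -(gaussian_second_moment (mX i) (gX i)).
by move=> j ji; rewrite integralZl// XX0 ?mule0// eq_sym.
Qed.

(** Chebyshev's inequality, as Markov's inequality for squaring, which is monotone on nonnegative
    reals. *)
Lemma weighted_sum_deviation n (X : 'I_n -> T -> R) (w : 'I_n -> R) (s e : R) :
  0 < s -> 0 < e -> (forall i, measurable_fun setT (X i)) ->
  mutually_independent Pr X -> (forall i, gaussian Pr (X i) 0 s) ->
  (Pr [set t | e <= `|\sum_i w i * X i t|]%R <= (e ^- 2)%:E *
    ((\sum_i w i ^+ 2)%:E * \int[normal_prob 0 s]_x (x ^+ 2)%:E))%E.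
Proof.
move=> s0 e0 mX indX gX; rewrite -(second_moment_sum w s0 mX indX gX).
have mS : measurable_fun setT (fun t => \sum_i w i * X i t).
  by apply: measurable_sum => i; exact: measurable_funM.
pose S : {RV Pr >-> R} := HB.pack (fun t => \sum_i w i * X i t)
  (isMeasurableFun.Build _ _ _ _ _ mS).
rewrite lee_pdivlMl ?exprn_gt0//.
have sqr_nneg : {in Num.nneg &, {homo (fun x : R => x ^+ 2) : x y / x <= y}}.
  by move=> x y x0 y0 xy; rewrite ler_sqr.
have := @markov _ _ _ Pr S (fun x => x ^+ 2) e e0 _ _ sqr_nneg.
rewrite unlock /=; under [X in _ -> _ -> (_ <= X)%E]eq_integral do
  rewrite real_normK ?num_real//.
apply; first exact: measurable_funX.
by move=> r _; exact: sqr_ge0.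
Qed.

End normal_moments.

(** * Finite-time wisdom and the conclusion *)

Lemma no_prominent_finite_time_wise (R : realType)
    (P : forall n : nat, 'M[R]_n) :
  (forall n, stochastic (P n)) ->
  (forall k, no_prominent_family (fun n => mxpow (P n) k)) ->
  finite_time_wise P.
Proof.
move=> sP hP d T Pr mu s xi s0 mxi indxi gxi k e e0.
have := normal_prob_second_moment_lty s0.
have : (0 <= \int[normal_prob 0 s]_x (x ^+ 2)%:E)%E.
  by apply: integral_ge0 => x _; rewrite lee_fin sqr_ge0.
case Em2 : (\int[_]_x _)%E => [m2| |]// _ _.
have sPk n := stochastic_mxpow k (sP n).
pose w n (j : 'I_n) := influence (mxpow (P n) k) [set j]%SET.
apply: (@squeeze_cvge _ _ _ _ (cst 0%E) _
  (fun n => (e ^- 2 * ((\sum_j w n j ^+ 2) * m2))%:E)); last 2 first.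
- exact: cvg_cst.
- apply: cvg_EFin; first by near=> n.
  have lim := cvgM (cvg_cst (e ^- 2))
    (cvgM (cvg_sum_influence_sqr sPk (hP k)) (cvg_cst m2)).
  by move: lim; rewrite mul0r mulr0; apply.
(* Positivity of [n] makes the weights sum to 1, so that [mu] cancels in [averageB]. *)
near=> n; have n0 : (0 < n)%N by near: n; exact: nbhs_infty_gt.
rewrite measure_ge0/=.
have := weighted_sum_deviation (w n) s0 e0 (mxi n) (indxi n) (gxi n).
have averageB t : average (opinions (P n) (\col_i (mu + xi n i t)) k) - mu =
    \sum_j w n j * xi n j t.
  rewrite opinionsE averageE; under eq_bigr do rewrite mxE mulrDr.
  by rewrite big_split/= -mulr_suml sum_influence_set1// mul1r addrAC subrr
    add0r.
by under eq_set do rewrite -averageB; rewrite Em2 -!EFinM.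
Unshelve. all: end_near. Qed.

Theorem theorem4 (R : realType) (P : forall n : nat, 'M[R]_n) :
  (forall n, stochastic (P n)) ->
  no_prominent_family P ->
  (forall k : nat, no_prominent_family (fun n => mxpow (P n) k)) /\
  finite_time_wise P.
Proof.
move=> sP hP; have hPk k := no_prominent_family_mxpow k sP hP.
by split=> //; exact: no_prominent_finite_time_wise.
Qed.
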